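(* Let $M$ be a simple, cosimple, connected elementary split matroid on the ground set $E$. Then \[ \bigl|\{e\in E: M\setminus e\text{ is disconnected}\}\bigr| +\bigl|\{e\in E: M/e\text{ is disconnected}\}\bigr| \le 1 . \] In particular, there exists an element $e\in E$ such that the deletion $M\setminus e$ and the contraction $M/e$ are both connected.
   Context: All matroids are finite, and connected matroids are required to have nonempty ground sets. A matroid is cosimple if its dual is simple. A subset $A$ of the ground set $E$ of a matroid $M$ is cyclic if it is a (possibly empty) union of circuits. A cyclic flat is a flat that is cyclic. If $M$ is loopless and coloopless, then $\varnothing$ and $E$ are cyclic flats, and the cyclic flats other than $\varnothing$ and $E$ are called the proper cyclic flats of $M$. A loopless, coloopless matroid is elementary split if and only if its proper cyclic flats are pairwise incomparable under inclusion. (A simple, cosimple matroid is loopless and coloopless. For connected matroids on at least two elements, elementary split is equivalent to split.) *)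

(* Defs.v *)
From mathcomp Require Import all_boot.

Set Implicit Arguments.
Unset Strict Implicit.
Unset Printing Implicit Defensive.

(* The ground set is a subset of an ambient finite type [T], so that the minors
   of a matroid over [T] are again matroids over [T]. *)
Record matroid (T : finType) := Matroid {
  ground : {set T};
  indep : {set {set T}};
  indep_ground : forall I, I \in indep -> I \subset ground;
  indep0 : set0 \in indep;
  indepS : forall I J : {set T}, J \in indep -> I \subset J -> I \in indep;
  indep_aug : forall I J : {set T}, I \in indep -> J \in indep -> #|I| < #|J| ->
    exists2 x, x \in J :\: I & x |: I \in indep
}.

Section Notions.

Variables (T : finType) (M : matroid T).
Implicit Types (A B C F I J X : {set T}) (e f : T).

Definition bases : {set {set T}} := [set B | maxset [in indep M] B].

Definition circuits : {set {set T}} :=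
  [set C | minset (fun X => (X \subset ground M) && (X \notin indep M)) C].

Definition rank X : nat := \max_(I in indep M | I \subset X) #|I|.

Definition closure X : {set T} :=
  [set e in ground M | rank (e |: X) == rank X].

Definition flat F : bool := (F \subset ground M) && (closure F == F).

Definition cyclic A : bool :=
  [exists P : {set {set T}}, (P \subset circuits) && (A == cover P)].

Definition cyclic_flat F : bool := flat F && cyclic F.

Definition proper_cyclic_flat F : bool :=
  [&& cyclic_flat F, F != set0 & F != ground M].

(* Elementary split matroids are described by their cyclic flats; this is the
   description for loopless and coloopless matroids. *)
Definition elementary_split : bool :=
  [forall F, forall F',
     [&& proper_cyclic_flat F, proper_cyclic_flat F' & F != F'] ==>
     ~~ (F \subset F')].

Definition loop e : bool := [set e] \in circuits.

Definition parallel e f : bool := (e != f) && ([set e; f] \in circuits).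

Definition simple : bool :=
  [forall e, ~~ loop e] && [forall e, forall f, ~~ parallel e f].

Definition connected : bool :=
  (ground M != set0) &&
  [forall e in ground M, forall f in ground M,
     (e != f) ==> [exists C in circuits, (e \in C) && (f \in C)]].

Definition disconnected : bool := ~~ connected.

Lemma base_indep B : B \in bases -> B \in indep M.
Proof. by rewrite inE => /maxsetP[]. Qed.

Lemma indep_card_base B I : B \in bases -> I \in indep M -> #|I| <= #|B|.
Proof.
rewrite inE => /maxsetP[iB maxB] iI; rewrite leqNgt; apply/negP => ltBI.
have [x /setDP[_ xB] ixB] := indep_aug iB iI ltBI.
by move: xB; rewrite -(maxB _ ixB (subsetU1 _ _)) setU11.
Qed.

Lemma indep_card_geP B I :
  B \in bases -> I \in indep M -> #|B| <= #|I| -> I \in bases.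
Proof.
move=> bB iI leBI; rewrite inE; apply/maxsetP; split=> // J iJ sIJ.
apply/esym/eqP; rewrite eqEcard sIJ /=.
exact: leq_trans (indep_card_base bB iJ) leBI.
Qed.

Lemma base_exists : exists B, B \in bases.
Proof.
have [B maxB _] := maxset_exists (P := [in indep M]) (indep0 M).
by exists B; rewrite inE.
Qed.

Lemma base_extend B I :
  B \in bases -> I \in indep M ->
  exists B', [/\ B' \in bases, I \subset B' & B' \subset I :|: B].
Proof.
move=> bB iI.
pose P J := [&& J \in indep M, I \subset J & J \subset I :|: B].
have PI : P I by rewrite /P iI subxx subsetUl.
have [J /maxsetP[PJ maxJ] _] := maxset_exists (P := P) PI.
have /and3P[iJ sIJ sJ] := PJ.
exists J; split=> //; apply: (indep_card_geP bB iJ).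
rewrite leqNgt; apply/negP => ltJB.
have [x /setDP[xB xJ] ixJ] := indep_aug iJ (base_indep bB) ltJB.
have PxJ : P (x |: J).
  by rewrite /P ixJ (subset_trans sIJ (subsetU1 _ _)) subUset sub1set inE xB orbT.
by move: xJ; rewrite -(maxJ _ PxJ (subsetU1 _ _)) setU11.
Qed.

Definition dual_indep : {set {set T}} :=
  [set I : {set T} | [exists B in bases, I \subset ground M :\: B]].

Lemma dual_indep_ground I : I \in dual_indep -> I \subset ground M.
Proof.
by rewrite inE => /exists_inP[B _ sI]; apply: subset_trans sI (subsetDl _ _).
Qed.

Lemma dual_indep0 : set0 \in dual_indep.
Proof.
by have [B bB] := base_exists; rewrite inE; apply/exists_inP; exists B;
  rewrite ?sub0set.
Qed.

Lemma dual_indepS I J : J \in dual_indep -> I \subset J -> I \in dual_indep.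
Proof.
rewrite !inE => /exists_inP[B bB sJ] sIJ; apply/exists_inP; exists B => //.
exact: subset_trans sIJ sJ.
Qed.

Lemma dual_indep_aug I J :
  I \in dual_indep -> J \in dual_indep -> #|I| < #|J| ->
  exists2 x, x \in J :\: I & x |: I \in dual_indep.
Proof.
move=> dI dJ ltIJ; have sIE := dual_indep_ground dI.
have sJE := dual_indep_ground dJ.
move: dI dJ; rewrite !inE => /exists_inP[B1 bB1 sI] /exists_inP[B2 bB2 sJ].
have iD : B2 :\: I \in indep M := indepS (base_indep bB2) (subsetDl _ _).
have [B [bB sDB sB]] := base_extend bB1 iD.
have disIB : [disjoint I & B].
  rewrite disjoint_sym; apply: (disjointWl sB).
  rewrite disjoint_sym disjoints_subset; apply/subsetP => x xI.
  move/subsetP: sI => /(_ x xI); rewrite !inE xI /= => /andP[xB1 _].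
  by rewrite (negbTE xB1).
have [sJIB | /subsetPn[x xJI xB]] := boolP (J :\: I \subset B); last first.
  exists x => //; rewrite inE; apply/exists_inP; exists B => //.
  move: xJI => /setDP[xJ _]; rewrite subUset sub1set !inE xB /=.
  by rewrite (subsetP sJE) //= subsetD sIE.
have disJB2 : [disjoint J & B2] by move: sJ; rewrite subsetD => /andP[].
have sU : (J :\: I) :|: (B2 :\: I) \subset B by rewrite subUset sJIB.
have disU : (J :\: I) :&: (B2 :\: I) = set0.
  apply/setP => x; rewrite !inE; apply/negP => /andP[/andP[_ xJ] /andP[_ xB2]].
  by move/disjointFr: disJB2 => /(_ x xJ); rewrite xB2.
have := subset_leq_card sU; rewrite cardsU disU cards0 subn0.
have leB := indep_card_base bB2 (base_indep bB).
have sIB2 : B2 :&: I \subset I :\: J.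
  apply/subsetP => x; rewrite !inE => /andP[xB2 ->]; rewrite andbT.
  by apply/negP => xJ; move/disjointFr: disJB2 => /(_ x xJ); rewrite xB2.
have := subset_leq_card sIB2.
have := cardsID I B2; have := cardsID J I; have := cardsID I J.
rewrite [J :&: I]setIC => eJ eI eB2 le1 le2; exfalso.
have le3 := leq_trans le2 leB.
move: ltIJ; rewrite -eJ -eI ltn_add2l ltnNge => /negP; apply.
apply: leq_trans le1.
by rewrite -(leq_add2r #|B2 :\: I|) eB2.
Qed.

Definition dual : matroid T :=
  Matroid dual_indep_ground dual_indep0 dual_indepS dual_indep_aug.

Definition del_indep X : {set {set T}} :=
  [set I in indep M | I \subset ground M :\: X].

Lemma del_indep_ground X I : I \in del_indep X -> I \subset ground M :\: X.
Proof. by rewrite inE => /andP[]. Qed.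

Lemma del_indep0 X : set0 \in del_indep X.
Proof. by rewrite inE indep0 sub0set. Qed.

Lemma del_indepS X I J : J \in del_indep X -> I \subset J -> I \in del_indep X.
Proof.
rewrite !inE => /andP[iJ sJ] sIJ.
by rewrite (indepS iJ sIJ) (subset_trans sIJ sJ).
Qed.

Lemma del_indep_aug X I J :
  I \in del_indep X -> J \in del_indep X -> #|I| < #|J| ->
  exists2 x, x \in J :\: I & x |: I \in del_indep X.
Proof.
rewrite !inE => /andP[iI sI] /andP[iJ sJ] ltIJ.
have [x xJI ixI] := indep_aug iI iJ ltIJ; exists x => //.
by rewrite inE ixI subUset sub1set sI (subsetP sJ) //; case/setDP: xJI.
Qed.

Definition deletion X : matroid T :=
  Matroid (@del_indep_ground X) (del_indep0 X) (@del_indepS X)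
    (@del_indep_aug X).

End Notions.

Definition cosimple (T : finType) (M : matroid T) : bool := simple (dual M).

(* M / X = (M^* \ X)^* *)
Definition contraction (T : finType) (M : matroid T) (X : {set T}) : matroid T :=
  dual (deletion (dual M) X).

(* Main.v *)
Require Import Defs.
From mathcomp Require Import all_boot.
From mathcomp Require Import zify.

(** The whole argument takes place in the rank function [r] of [M], on the
    ground set [E].

    If [M \ e] is disconnected, a separation of it writes [E - e] as a disjoint
    union [A + B] with [r A + r B = r E].  Connectedness of [M] keeps [e] out of
    the spans of [A] and [B], so both are flats, and cosimplicity (no two
    elements in series) leaves no coloop in either: [A] and [B] are proper
    cyclic flats ([deletion_split_exists]).  Dually, if [M / f] is disconnected,
    there are proper cyclic flats [X] and [Y] with union [E], intersection
    [{f}] and [r X + r Y = r E + 1] ([contraction_split_exists]).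

    Incomparability of proper cyclic flats makes these decompositions rigid.
    Inside [M \ e], a cyclic flat is the direct sum of its traces on [A] and
    [B], and these are again cyclic flats; hence a nonempty cyclic flat avoiding
    [e] is [A] or [B] ([cyclic_flat_avoiding]).  Dually, a cyclic flat other than
    [E] that contains [f] is [X] or [Y] ([cyclic_flat_containing]).

    Now compare two decompositions.  Two of the same kind, at distinct elements,
    share one of their flats, and comparing ranks puts one of the two elements
    in the span of a flat that misses it ([deletion_split_unique],
    [contraction_split_unique]).  A decomposition of each kind, at distinct
    elements, gives [Y = A] and then [B] strictly inside [X]
    ([not_both_split_neq]); at the same element [e], adding up ranks shows that
    [X] and [Y] cut [A] or [B] into two direct summands, and that flat then lies
    inside [X] or [Y] ([not_both_split_eq]).  So at most one element is bad, and
    only in one way; since [E] has more than one element, some element is good.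

    Connectedness is stated through circuits, so rank separations have to be
    recovered from the absence of common circuits.  This uses that lying in a
    common circuit is transitive ([circuit_transitive]). *)

Set Implicit Arguments.
Unset Strict Implicit.
Unset Printing Implicit Defensive.

(** The facts to be used must be premises of the goal: boolean hypotheses are
    dropped, and cardinals and ranks become variables, because [lia] would
    otherwise spend its time comparing finite sets up to conversion. *)
Ltac card_lia :=
  repeat match goal with H : is_true _ |- _ => clear H end;
  repeat match goal with |- context [rank ?M ?X] =>
    let n := fresh "n" in set n := (rank M X); clearbody n end;
  repeat match goal with |- context [card ?A] =>
    let n := fresh "n" in set n := (card A); clearbody n end;
  lia.

(** * Rank, circuits and separations *)

Section RankTheory.

Variables (T : finType) (M : matroid T).
Implicit Types (A B C D F G I J U W X Y Z : {set T}) (e f x y : T).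

Local Notation r := (rank M).
Local Notation E := (ground M).

Lemma rank_ge X I : I \in indep M -> I \subset X -> #|I| <= r X.
Proof. by move=> iI sI; apply: (bigmax_sup I); rewrite ?iI ?sI. Qed.

Lemma rank_le_card X : r X <= #|X|.
Proof. by apply/bigmax_leqP => I /andP[_ sI]; apply: subset_leq_card. Qed.

Lemma rankS X Y : X \subset Y -> r X <= r Y.
Proof.
move=> sXY; apply/bigmax_leqP => I /andP[iI sI].
exact: rank_ge iI (subset_trans sI sXY).
Qed.

Lemma rank_basis_ext I X : I \in indep M -> I \subset X ->
  exists J, [/\ J \in indep M, I \subset J, J \subset X & #|J| = r X].
Proof.
move=> iI sIX; pose P J := (J \in indep M) && (J \subset X).
have [|J /maxsetP[/andP[iJ sJX] maxJ] sIJ] := @maxset_exists _ P I.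
  by rewrite /P iI.
exists J; split=> //; apply/eqP; rewrite eqn_leq rank_ge //=.
apply/bigmax_leqP => K /andP[iK sKX]; rewrite leqNgt; apply/negP => ltJK.
have [x /setDP[xK xJ] ixJ] := indep_aug iJ iK ltJK.
have PxJ : P (x |: J) by rewrite /P ixJ subUset sub1set (subsetP sKX) ?sJX.
by move: xJ; rewrite -(maxJ _ PxJ (subsetU1 _ _)) setU11.
Qed.

Lemma rank_basis X : exists J, [/\ J \in indep M, J \subset X & #|J| = r X].
Proof.
by have [J [? _ ? ?]] := rank_basis_ext (indep0 M) (sub0set X); exists J.
Qed.

Lemma rank_indep I : I \in indep M -> r I = #|I|.
Proof. by move=> iI; apply/eqP; rewrite eqn_leq rank_le_card rank_ge. Qed.

Lemma indep_rank X : r X = #|X| -> X \in indep M.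
Proof.
have [J [iJ sJ cJ]] := rank_basis X => eX; have /eqP <- // : J == X.
by rewrite eqEcard sJ cJ eX leqnn.
Qed.

Lemma rank_submod X Y : r (X :|: Y) + r (X :&: Y) <= r X + r Y.
Proof.
have [I [iI sI <-]] := rank_basis (X :&: Y).
have sIU : I \subset X :|: Y.
  apply: subset_trans sI _.
  exact: subset_trans (subsetIl _ _) (subsetUl _ _).
have [J [iJ sIJ sJ <-]] := rank_basis_ext iI sIU.
have leX : #|J :&: X| <= r X.
  by apply: rank_ge; rewrite ?subsetIr // (indepS iJ) ?subsetIl.
have leY : #|J :&: Y| <= r Y.
  by apply: rank_ge; rewrite ?subsetIr // (indepS iJ) ?subsetIl.
apply: leq_trans (leq_add leX leY).
rewrite -(cardsUI (J :&: X)) -setIUr (setIidPl sJ) leq_add2l -setIIr.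
by apply: subset_leq_card; rewrite subsetI sIJ.
Qed.

Lemma rankU X Y : r (X :|: Y) <= r X + r Y.
Proof. exact: leq_trans (leq_addr _ _) (rank_submod X Y). Qed.

(** Submodularity in the form in which it is applied: the union and the
    intersection need only be known up to inclusion. *)
Lemma rank_submod_le X Y U W :
  U \subset X :|: Y -> W \subset X -> W \subset Y -> r U + r W <= r X + r Y.
Proof.
move=> sU sX sY; apply: leq_trans (rank_submod X Y).
by apply: leq_add; apply: rankS; rewrite ?subsetI ?sX.
Qed.

Lemma rank_span x X Y : r (x |: X) = r X -> X \subset Y -> r (x |: Y) = r Y.
Proof.
move=> eX sXY; apply/eqP; rewrite eqn_leq [X in _ && X]rankS ?subsetU1 // andbT.
have : r (x |: Y) + r X <= r (x |: X) + r Y.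
  by apply: rank_submod_le => //; rewrite ?subsetU1 // -setUA setUS // subsetUr.
by move: eX; card_lia.
Qed.

(** Having no coloop passes to larger sets element by element; this is how sets
    are shown to be unions of circuits without exhibiting the circuits. *)
Lemma rank_noncoloop x X Y :
  x \in X -> r (X :\ x) = r X -> X \subset Y -> r (Y :\ x) = r Y.
Proof.
move=> xX eX sXY; have xY := subsetP sXY x xX.
have eX' : r (x |: X :\ x) = r (X :\ x) by rewrite setD1K.
by have := rank_span eX' (setSD [set x] sXY); rewrite setD1K.
Qed.

Lemma dep_circuit X : X \subset E -> X \notin indep M ->
  exists2 C, C \in circuits M & C \subset X.
Proof.
move=> sX dX.
have [|C mC sC] := @minset_exists _
  (fun Y => (Y \subset E) && (Y \notin indep M)) X; first by rewrite sX.
by exists C; rewrite // inE.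
Qed.

Lemma circuit_ground C : C \in circuits M -> C \subset E.
Proof. by rewrite inE => /minsetP[/andP[]]. Qed.

Lemma circuit_dep C : C \in circuits M -> C \notin indep M.
Proof. by rewrite inE => /minsetP[/andP[]]. Qed.

Lemma circuit_proper_indep C X :
  C \in circuits M -> X \proper C -> X \in indep M.
Proof.
rewrite inE => /minsetP[/andP[sC _] minC] /properP[sXC [x xC xX]].
apply: contraT => dX; move: xX; rewrite (minC X) ?xC //.
by rewrite dX (subset_trans sXC).
Qed.

Lemma circuit_sub_eq C D :
  C \in circuits M -> D \in circuits M -> C \subset D -> C = D.
Proof.
move=> cC cD sCD; apply/eqP; rewrite eqEproper sCD; apply/negP => pCD.
by move: (circuit_dep cC); rewrite (circuit_proper_indep cD).
Qed.

Lemma circuitD1_indep C x : C \in circuits M -> x \in C -> C :\ x \in indep M.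
Proof. by move=> cC xC; apply: circuit_proper_indep cC (properD1 xC). Qed.

Lemma circuit_rank C x : C \in circuits M -> x \in C -> r (C :\ x) = r C.
Proof.
move=> cC xC; apply/eqP; rewrite eqn_leq rankS ?subsetDl //=.
rewrite (rank_indep (circuitD1_indep cC xC)) -ltnS.
have := cardsD1 x C; rewrite xC add1n => <-; rewrite ltn_neqAle rank_le_card.
rewrite andbT; apply/eqP => /indep_rank; exact/negP/circuit_dep.
Qed.

Lemma circuit_through x X : x \in E -> X \subset E -> x \notin X ->
  r (x |: X) = r X ->
  exists C, [/\ C \in circuits M, x \in C & C \subset x |: X].
Proof.
move=> xE sX xX eX; have [J [iJ sJ cJ]] := rank_basis X.
have xJ : x \notin J by apply: contra xX; apply: subsetP.
have dJ : x |: J \notin indep M.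
  apply/negP => ixJ; have := rank_ge ixJ (setUS _ sJ).
  by rewrite cardsU1 xJ eX cJ; card_lia.
have sJE : x |: J \subset E by rewrite subUset sub1set xE (subset_trans sJ).
have [C cC sC] := dep_circuit sJE dJ; exists C; split=> //; last first.
  exact: subset_trans sC (setUS _ sJ).
apply: contraR (circuit_dep cC) => xC; apply: (indepS iJ).
by rewrite -(setU1K xJ) subsetD1 sC.
Qed.

(** Since [D - x] spans [x] and avoids [e], the set [(C + D) - x - e] spans
    [C - e], hence [e]; so [e] closes a circuit with it. *)
Lemma strong_elimination C D x e :
  C \in circuits M -> D \in circuits M -> x \in C -> x \in D ->
  e \in C -> e \notin D ->
  exists C', [/\ C' \in circuits M, e \in C' & C' \subset (C :|: D) :\ x].
Proof.
move=> cC cD xC xD eC eD.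
have nex : e != x by apply: contraNneq eD => ->.
pose X := (C :|: D) :\ x :\ e.
have sE : C :|: D \subset E by rewrite subUset !circuit_ground.
have eX : r (x |: X) = r X.
  apply: (@rank_span _ (D :\ x)); first by rewrite setD1K ?circuit_rank.
  apply/subsetP => y; rewrite !inE => /andP[-> yD]; rewrite yD orbT !andbT.
  by apply: contraNneq eD => <-.
have eeX : r (e |: (x |: X)) = r (x |: X).
  apply: (@rank_span _ (C :\ e)); first by rewrite setD1K ?circuit_rank.
  apply/subsetP => y; rewrite !inE => /andP[-> yC]; rewrite yC /= andbT.
  by case: eqP.
have [| | | |C' [cC' eC' sC']] := @circuit_through e X.
- exact: (subsetP (circuit_ground cC)).
- exact: subset_trans (subset_trans (subsetDl _ _) (subsetDl _ _)) sE.
- by rewrite !inE eqxx.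
- apply/eqP; rewrite eqn_leq [X in _ && X]rankS ?subsetU1 // andbT.
  rewrite -eX -eeX; apply: rankS; apply: setUS; exact: subsetU1.
exists C'; split=> //; apply: subset_trans sC' _.
by rewrite subUset sub1set subsetDl !inE nex eC.
Qed.

(** Induction on the size of [C :|: D].  Eliminating a common element [x] gives
    a circuit [C3] through [e] and a circuit [D3] through [g].  [C] and [D3]
    meet, and if their union is not smaller, then [C3] and [D3] meet and have a
    smaller union. *)
Lemma circuit_transitive C D e g :
  C \in circuits M -> D \in circuits M -> C :&: D != set0 ->
  e \in C -> g \in D ->
  exists2 C', C' \in circuits M & (e \in C') && (g \in C').
Proof.
move: {2}_.+1 (ltnSn #|C :|: D|) => n.
elim: n C D => // n IH C D; rewrite ltnS => leUn cC cD.
case/set0Pn=> x /setIP[xC xD] eC gD.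
have [eD|eD] := boolP (e \in D); first by exists D; rewrite ?eD.
have [gC|gC] := boolP (g \in C); first by exists C; rewrite ?eC.
have [C3 [cC3 eC3 sC3]] := strong_elimination cC cD xC xD eC eD.
have [D3 [cD3 gD3 sD3]] := strong_elimination cD cC xD xC gD gC.
have sC3U : C3 \subset C :|: D := subset_trans sC3 (subsetDl _ _).
have sD3U : D3 \subset C :|: D.
  by rewrite setUC; apply: subset_trans sD3 (subsetDl _ _).
have xU : x \in C :|: D by rewrite inE xC.
have ltU X : X \subset C :|: D -> X != C :|: D -> #|X| < n.
  move=> sX nX; apply: leq_trans leUn.
  by apply: proper_card; rewrite properEneq nX.
have [y yC3 yC] : exists2 y, y \in C3 & y \notin C.
  apply/subsetPn; apply: contraTN sC3 => /(circuit_sub_eq cC3 cC) ->.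
  by apply/negP => /subsetP/(_ x xC); rewrite !inE eqxx.
have [z zD3 zD] : exists2 z, z \in D3 & z \notin D.
  apply/subsetPn; apply: contraTN sD3 => /(circuit_sub_eq cD3 cD) ->.
  by apply/negP => /subsetP/(_ x xD); rewrite !inE eqxx.
have yD : y \in D.
  by move/subsetP/(_ y yC3): sC3U; rewrite inE (negbTE yC).
have zC : z \in C.
  by move/subsetP/(_ z zD3): sD3U; rewrite inE (negbTE zD) orbF.
(* If [C] and [D3] do not have a smaller union, then [D3] contains all of
   [D] outside [C], in particular [y]; so it meets [C3], and both miss [x]. *)
have [eqC|neC] := eqVneq (C :|: D3) (C :|: D); last first.
  apply: (IH C D3) => //; last by apply/set0Pn; exists z; rewrite inE zC.
  by apply: ltU => //; rewrite subUset subsetUl.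
apply: (IH C3 D3) => //.
  apply: ltU; first by rewrite subUset sC3U.
  apply/eqP => eqU; move: xU; rewrite -eqU inE => /orP[] /(subsetP _).
    by move=> /(_ _ sC3); rewrite !inE eqxx.
  by move=> /(_ _ sD3); rewrite !inE eqxx.
apply/set0Pn; exists y; rewrite inE yC3.
have: y \in C :|: D3 by rewrite eqC inE yD orbT.
by rewrite inE (negbTE yC).
Qed.

Definition separation A B : Prop :=
  [/\ A != set0, B != set0, A :|: B = E, A :&: B = set0 & r A + r B <= r E].

(** Restricting a direct sum to a subset gives a direct sum. *)
Lemma rank_separated A B X : r A + r B <= r (A :|: B) -> A :&: B = set0 ->
  X \subset A :|: B -> r X = r (X :&: A) + r (X :&: B).
Proof.
move=> eAB dAB sX; apply/eqP; rewrite eqn_leq; apply/andP; split.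
  by apply: leq_trans (rankU _ _); apply: rankS; rewrite -setIUr subsetI subxx.
have h1 : r (X :|: A) + r (X :&: A) <= r X + r A := rank_submod X A.
have h2 : r (A :|: B) + r (X :&: B) <= r (X :|: A) + r B.
  apply: rank_submod_le; rewrite ?subsetIr //.
    by rewrite setSU // subsetUr.
  exact: subset_trans (subsetIl _ _) (subsetUl _ _).
by move: eAB h1 h2; card_lia.
Qed.

(** A circuit meeting both sides would have rank [#|C|], as its traces on the
    two sides are independent. *)
Lemma connected_separation A B : connected M -> ~ separation A B.
Proof.
case/andP=> _ /forall_inP conn [/set0Pn[a aA] /set0Pn[b bB] eAB dAB le].
have aE : a \in E by rewrite -eAB inE aA.
have bE : b \in E by rewrite -eAB inE bB orbT.
have nAB x : x \in A -> x \notin B.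
  by move=> xA; apply/negP => xB; have := in_set0 x; rewrite -dAB inE xA xB.
have aB := nAB a aA.
have bA : b \notin A by apply: contraL bB; apply: nAB.
have nab : a != b by apply: contraNneq aB => ->.
have /exists_inP[C cC /andP[aC bC]] :=
  implyP (forall_inP (conn a aE) b bE) nab.
rewrite -eAB in le.
have sC : C \subset A :|: B by rewrite eAB circuit_ground.
have iA : C :&: A \in indep M.
  apply: (circuit_proper_indep cC); apply/properP; split; first exact: subsetIl.
  by exists b; rewrite // inE (negbTE bA) andbF.
have iB : C :&: B \in indep M.
  apply: (circuit_proper_indep cC); apply/properP; split; first exact: subsetIl.
  by exists a; rewrite // inE (negbTE aB) andbF.
have := rank_separated le dAB sC; rewrite (rank_indep iA) (rank_indep iB).
have := cardsUI (C :&: A) (C :&: B).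
rewrite -setIUr (setIidPl sC) setIACA dAB setI0 cards0 addn0 => <-.
by move/indep_rank; apply/negP/circuit_dep.
Qed.

(** The elements sharing a circuit with [a] form a set [A] that contains every
    circuit it meets; so a basis of [A] and one of its complement together
    contain no circuit. *)
Lemma disconnected_separation : E != set0 -> disconnected M ->
  exists A B, separation A B.
Proof.
move=> E0; rewrite /disconnected /connected E0 /= negb_forall_in.
case/exists_inP=> a aE; rewrite negb_forall_in => /exists_inP[b bE].
rewrite negb_imply => /andP[nab /exists_inPn noC].
pose A := [set x in E | (x == a) ||
  [exists C in circuits M, (a \in C) && (x \in C)]].
have aA : a \in A by rewrite !inE aE eqxx.
have bA : b \notin A.
  rewrite !inE bE eq_sym (negbTE nab) /=; apply/exists_inP => -[C cC].
  by apply/negP/noC.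
have closedA C x : C \in circuits M -> x \in C -> x \in A -> C \subset A.
  move=> cC xC; rewrite inE => /andP[_ xA]; apply/subsetP => y yC.
  rewrite inE (subsetP (circuit_ground cC)) //=; apply/orP; right.
  case/orP: xA => [/eqP xa|/exists_inP[D cD /andP[aD xD]]].
    by apply/exists_inP; exists C; rewrite // -xa xC.
  apply/exists_inP; apply: (@circuit_transitive D C) => //.
  by apply/set0Pn; exists x; rewrite inE xD.
have sA : A \subset E by apply/subsetP => x; rewrite inE => /andP[].
exists A, (E :\: A); split.
- by apply/set0Pn; exists a.
- by apply/set0Pn; exists b; rewrite inE bA.
- by rewrite -{2}(setID E A) (setIidPr sA).
- by rewrite setDE setICA setICr setI0.
have [I [iI sI <-]] := rank_basis A.
have [J [iJ sJ <-]] := rank_basis (E :\: A).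
have disIJ : I :&: J = set0.
  apply/setP => x; rewrite inE in_set0; apply/negP => /andP[xI xJ].
  by move/(subsetP sJ): xJ; rewrite inE (subsetP sI x xI).
rewrite -cardsUI disIJ cards0 addn0.
have sU : I :|: J \subset E.
  by rewrite subUset (subset_trans sI) // (subset_trans sJ) // subsetDl.
apply: rank_ge => //; apply: contraT => /(dep_circuit sU)[C cC sC].
case/negP: (circuit_dep cC).
have [|/pred0Pn[x /andP[/= xC xI]]] := boolP [disjoint C & I].
  move=> dCI; apply: (indepS iJ); apply/subsetP => x xC.
  by move/(subsetP sC): (xC); rewrite inE (disjointFr dCI xC).
apply: (indepS iI); apply/subsetP => y yC.
move/(subsetP sC): (yC); rewrite inE => /orP[//|/(subsetP sJ)].
by rewrite inE (subsetP (closedA C x cC xC (subsetP sI x xI))).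
Qed.

Lemma basesE B : (B \in bases M) = (B \in indep M) && (#|B| == r E).
Proof.
have base_card B' : B' \in bases M -> #|B'| = r E.
  move=> bB'; have iB' := base_indep bB'; apply/eqP.
  rewrite eqn_leq rank_ge ?indep_ground //=.
  by apply/bigmax_leqP => I /andP[iI _]; exact: (indep_card_base bB' iI).
apply/idP/andP=> [bB|[iB /eqP cB]].
  by rewrite (base_indep bB) (base_card _ bB).
have [B' bB'] := base_exists M.
by apply: (indep_card_geP bB' iB); rewrite (base_card _ bB') cB.
Qed.

(** A base minimising its trace on [X] leaves the largest subset of [X] that is
    independent in the dual. *)
Lemma dual_rank X : X \subset E -> rank (dual M) X + r E = #|X| + r (E :\: X).
Proof.
move=> sX; apply/eqP; rewrite eqn_leq; apply/andP; split.
  have : rank (dual M) X <= #|X| + r (E :\: X) - r E; last first.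
    have [J [iJ sJ <-]] := rank_basis E.
    have : #|J :\: X| <= r (E :\: X).
      by apply: rank_ge; rewrite ?setSD // (indepS iJ) ?subsetDl.
    have := cardsID X J; have := subset_leq_card (subsetIr J X); card_lia.
  apply/bigmax_leqP => I /andP[/=]; rewrite inE => /exists_inP[B].
  rewrite basesE => /andP[iB /eqP <-]; rewrite subsetD => /andP[_ dIB] sI.
  have le : #|B :\: X| <= r (E :\: X).
    by apply: rank_ge; rewrite ?setSD ?indep_ground // (indepS iB) ?subsetDl.
  have : #|B :&: X| + #|I| <= #|X|.
    rewrite -cardsUI; have -> : B :&: X :&: I = set0.
      apply/setP => x; rewrite !inE; apply/negP => /andP[/andP[xB _] xI].
      by move: xB; rewrite (disjointFr dIB xI).
    by rewrite cards0 addn0 subset_leq_card // subUset subsetIr.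
  by have := cardsID X B; move: le; card_lia.
have [J [iJ sJ cJ]] := rank_basis (E :\: X).
have [B [iB sJB sB cB]] :=
  rank_basis_ext iJ (subset_trans sJ (subsetDl _ _)).
have le : #|X :\: B| <= rank (dual M) X.
  apply: (bigmax_sup (X :\: B)); rewrite ?subsetDl // andbT inE.
  by apply/exists_inP; exists B; rewrite ?setSD // basesE iB cB eqxx.
have := cardsID X B; have := cardsID B X; rewrite setIC -cB -cJ.
have := subset_leq_card (_ : J \subset B :\: X); rewrite subsetD sJB.
have -> : [disjoint J & X] by move: sJ; rewrite subsetD => /andP[].
by move=> /(_ isT); move: le; card_lia.
Qed.

Lemma deletion_rank D X : X \subset E :\: D -> rank (deletion M D) X = r X.
Proof.
move=> sX; apply: eq_bigl => I; rewrite inE -andbA; congr (_ && _).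
by rewrite andb_idl // => sI; apply: subset_trans sI sX.
Qed.

Lemma simple_indep X : simple M -> X \subset E -> #|X| <= 2 -> X \in indep M.
Proof.
case/andP=> /forallP noloop /forallP nopar sX cX; apply: contraT => dX.
have [C cC sC] := dep_circuit sX dX.
have : #|C| <= 2 := leq_trans (subset_leq_card sC) cX.
rewrite leq_eqVlt => /orP[/cards2P[x [y [nxy eC]]]|].
  by have := forallP (nopar x) y; rewrite /parallel nxy -eC cC.
rewrite ltnS leq_eqVlt => /orP[/cards1P[x eC]|].
  by have := noloop x; rewrite /loop -eC cC.
rewrite ltnS leqn0 cards_eq0 => /eqP eC.
by move: (circuit_dep cC); rewrite eC indep0.
Qed.

End RankTheory.

(** * Cyclic flats of an elementary split matroid *)

Section CyclicFlats.

Variables (T : finType) (M : matroid T).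
Implicit Types (A B C D F G H I J U W X Y Z : {set T}) (e f g x y : T).

Local Notation r := (rank M).
Local Notation E := (ground M).

(** Cyclic flats as closed sets without coloops, a form in which they are
    recognised by rank inequalities alone. *)
Definition rank_cyclic_flat F : Prop :=
  [/\ F \subset E,
      forall x, x \in E -> x \notin F -> r F < r (x |: F) &
      forall x, x \in F -> r (F :\ x) = r F].

Lemma rank_cyclic_flatW F : rank_cyclic_flat F -> cyclic_flat M F.
Proof.
case=> sF flatF cycF; apply/andP; split.
  rewrite /flat sF; apply/eqP/setP => x; rewrite inE.
  apply/andP/idP => [[xE /eqP eX]|xF].
    by apply: contraT => xF; have := flatF x xE xF; rewrite eX ltnn.
  by rewrite (subsetP sF) // (setUidPr _) ?sub1set.
apply/existsP; exists [set C in circuits M | C \subset F]; apply/andP; split.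
  by apply/subsetP => C; rewrite inE => /andP[].
apply/eqP/setP => x; apply/idP/bigcupP => [xF|[C]]; last first.
  by rewrite inE => /andP[_ sC] /(subsetP sC).
have [|||| C [cC xC sC]] := @circuit_through _ M x (F :\ x).
- exact: subsetP xF.
- exact: subset_trans (subsetDl _ _) sF.
- by rewrite !inE eqxx.
- by rewrite setD1K ?cycF.
by exists C; rewrite // inE cC -(setD1K xF).
Qed.

Lemma flat_rank_lt F G x : rank_cyclic_flat F -> G \subset F ->
  x \in E -> x \notin F -> r G < r (x |: G).
Proof.
case=> sF flatF _ sGF xE xF; rewrite ltn_neqAle rankS ?subsetU1 // andbT.
apply/eqP => eG; have := flatF x xE xF.
by rewrite (rank_span (esym eG) sGF) ltnn.
Qed.

(** An intersection of flats is a flat, but it may acquire coloops.  It does not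
    if it is a direct summand of a cyclic set [H], because a coloop of a summand
    is a coloop of [H]. *)
Lemma cyclic_flat_cap F G H W :
  rank_cyclic_flat F -> rank_cyclic_flat G -> rank_cyclic_flat H ->
  F :&: G \subset H -> H \subset (F :&: G) :|: W ->
  r (F :&: G) + r W <= r H -> rank_cyclic_flat (F :&: G).
Proof.
move=> cfF cfG [_ _ cycH] sH Hs le; split.
- by case: cfF => sF _ _; apply: subset_trans (subsetIl _ _) sF.
- move=> x xE; rewrite inE negb_and => /orP[xF|xG].
    exact: flat_rank_lt cfF (subsetIl _ _) xE xF.
  exact: flat_rank_lt cfG (subsetIr _ _) xE xG.
move=> x xFG; apply/eqP; rewrite eqn_leq rankS ?subsetDl //=.
have := cycH x (subsetP sH x xFG).
have : r (H :\ x) <= r ((F :&: G) :\ x) + r W.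
  apply: leq_trans (rankU _ _ _); apply: rankS; rewrite subDset setUA.
  by rewrite setD1K.
by move: le; card_lia.
Qed.

Lemma cyclic_flat_closure U : U \subset E ->
  (forall x, x \in U -> r (U :\ x) = r U) ->
  exists G, [/\ rank_cyclic_flat G, U \subset G & r G = r U].
Proof.
move=> sU cycU; pose P G := (G \subset E) && (r G == r U).
have [|G /maxsetP[/andP[sG /eqP eG] maxG] sUG] := @maxset_exists _ P U.
  by rewrite /P sU eqxx.
exists G; split=> //; split=> // x.
  move=> xE xG; rewrite ltn_neqAle rankS ?subsetU1 // andbT.
  apply: contra xG => /eqP eX; rewrite -(maxG (x |: G)) ?setU11 ?subsetU1 //.
  by rewrite /P subUset sub1set xE sG -eX eG eqxx.
move=> xG; have [xU|xU] := boolP (x \in U).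
  exact: rank_noncoloop xU (cycU x xU) sUG.
apply/eqP; rewrite eqn_leq rankS ?subsetDl //= eG.
by apply: rankS; rewrite subsetD1 sUG.
Qed.

Hypothesis M_split : elementary_split M.

Lemma cyclic_flat_sub_eq F G :
  rank_cyclic_flat F -> rank_cyclic_flat G ->
  F != set0 -> G != E -> F \subset G -> F = G.
Proof.
move=> cF cG F0 GE sFG; apply/eqP/idPn => nFG.
have := forallP (forallP M_split F) G.
rewrite sFG implybF /proper_cyclic_flat !rank_cyclic_flatW // F0 GE nFG andbT.
have -> : F != E.
  apply: contraNneq nFG => FE; rewrite eqEsubset sFG FE.
  by case: cG.
have -> // : G != set0.
by apply: contraNneq F0 => G0; rewrite -subset0 -G0.
Qed.

(** What a disconnected [M \ e] looks like inside [M]. *)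
Record deletion_split e A B : Prop := DeletionSplit {
  ds_ground : e \in E;
  ds_l : rank_cyclic_flat A;
  ds_r : rank_cyclic_flat B;
  ds_l0 : A != set0;
  ds_r0 : B != set0;
  ds_cover : A :|: B = E :\ e;
  ds_disj : A :&: B = set0;
  ds_rank : r A + r B <= r (E :\ e)
}.

(** What a disconnected [M / f] looks like inside [M]: in terms of a separation
    of [M / f], [X] and [Y] are its two sides with [f] added to each. *)
Record contraction_split f X Y : Prop := ContractionSplit {
  cs_ground : f \in E;
  cs_l : rank_cyclic_flat X;
  cs_r : rank_cyclic_flat Y;
  cs_lE : X != E;
  cs_rE : Y != E;
  cs_cover : X :|: Y = E;
  cs_meet : X :&: Y = [set f];
  cs_rank : r X + r Y <= r E + r [set f]
}.

Lemma deletion_splitC e A B : deletion_split e A B -> deletion_split e B A.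
Proof. by case=> *; split=> //; rewrite 1?setUC 1?setIC 1?addnC. Qed.

Lemma contraction_splitC f X Y :
  contraction_split f X Y -> contraction_split f Y X.
Proof. by case=> *; split=> //; rewrite 1?setUC 1?setIC 1?addnC. Qed.

Lemma ds_notin e A B : deletion_split e A B -> e \notin A.
Proof.
by move=> ds; have := subsetUl A B; rewrite (ds_cover ds) subsetD1 => /andP[].
Qed.

Lemma ds_neqE e A B : deletion_split e A B -> A != E.
Proof.
by move=> ds; apply: contraNneq (ds_notin ds) => ->; apply: ds_ground ds.
Qed.

Lemma ds_in e A B x : deletion_split e A B -> x \in E -> x != e ->
  (x \in B) = (x \notin A).
Proof.
move=> ds xE nxe; have /setP/(_ x) := ds_cover ds.
have /setP/(_ x) := ds_disj ds.
by rewrite !inE nxe xE; case: (x \in A); case: (x \in B).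
Qed.

Lemma ds_compl e A B : deletion_split e A B -> A = E :\ e :\: B.
Proof.
move=> ds; rewrite -(ds_cover ds) setDUl setDv setU0.
by apply/esym/setDidPl; rewrite -setI_eq0 (ds_disj ds).
Qed.

Lemma cs_in f X Y : contraction_split f X Y -> f \in X.
Proof.
by move=> cs; have /setP/(_ f) := cs_meet cs; rewrite !inE eqxx => /andP[].
Qed.

Lemma cs_neq0 f X Y : contraction_split f X Y -> X != set0.
Proof. by move=> cs; apply/set0Pn; exists f; apply: cs_in cs. Qed.

Lemma cs_notin f X Y x : contraction_split f X Y -> x \in E -> x != f ->
  (x \in Y) = (x \notin X).
Proof.
move=> cs xE nxf; have /setP/(_ x) := cs_cover cs.
have /setP/(_ x) := cs_meet cs.
by rewrite !inE (negbTE nxf) xE; case: (x \in X); case: (x \in Y).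
Qed.

Lemma cs_compl f X Y : contraction_split f X Y -> Y :\ f = E :\: X.
Proof.
move=> cs; rewrite -(cs_cover cs) setDUl setDv set0U -(cs_meet cs).
by rewrite setDIr setDv setU0.
Qed.

(** If [F] meets [A], the trace of [F] on [A] is a direct summand of [F], hence
    a nonempty cyclic flat inside both [F] and [A]: it equals both. *)
Lemma cyclic_flat_avoiding e A B F : deletion_split e A B ->
  rank_cyclic_flat F -> F != set0 -> e \notin F -> F = A \/ F = B.
Proof.
move=> ds cF F0 eF; have sFE : F \subset E by case: cF.
have FE : F != E by apply: contraNneq eF => ->; apply: ds_ground ds.
have half A' B' : deletion_split e A' B' -> F :&: A' != set0 -> F = A'.
  move=> ds' FA0.
  have sF : F \subset A' :|: B' by rewrite (ds_cover ds') subsetD1 sFE.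
  have le : r A' + r B' <= r (A' :|: B').
    by rewrite (ds_cover ds') (ds_rank ds').
  have cFA : rank_cyclic_flat (F :&: A').
    apply: (cyclic_flat_cap cF (ds_l ds') cF (W := F :&: B')).
    - exact: subsetIl.
    - by rewrite -setIUr subsetI subxx.
    - by rewrite -(rank_separated le (ds_disj ds') sF).
  rewrite -(cyclic_flat_sub_eq cFA cF FA0 FE (subsetIl _ _)).
  exact: cyclic_flat_sub_eq cFA (ds_l ds') FA0 (ds_neqE ds') (subsetIr _ _).
have [FA0|] := eqVneq (F :&: A) set0; last by left; apply: (half A B).
right; apply: (half B A (deletion_splitC ds)).
have [x xF] := set0Pn _ F0; apply/set0Pn; exists x; rewrite inE xF.
rewrite (ds_in ds) ?(subsetP sFE) //; last by apply: contraNneq eF => <-.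
by have /setP/(_ x) := FA0; rewrite !inE xF => /= ->.
Qed.

(** If [X :|: F] does not span [E], its closure is a proper cyclic flat above
    both [X] and [F], which are then equal.  Submodularity shows that
    [X :|: F] and [Y :|: F] cannot both span [E]. *)
Lemma cyclic_flat_containing f X Y F : contraction_split f X Y ->
  rank_cyclic_flat F -> F != E -> f \in F -> F = X \/ F = Y.
Proof.
move=> cs cF FE fF; have [sFE flatF cycF] := cF.
have F0 : F != set0 by apply/set0Pn; exists f.
have half X' Y' : contraction_split f X' Y' -> r (X' :|: F) < r E -> F = X'.
  move=> cs' ltXF; have [sX _ cycX] := cs_l cs'.
  have [||G [cG sG rG]] := @cyclic_flat_closure (X' :|: F).
  - by rewrite subUset sX.
  - move=> x; rewrite inE => /orP[xX|xF].
      exact: rank_noncoloop xX (cycX x xX) (subsetUl _ _).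
    exact: rank_noncoloop xF (cycF x xF) (subsetUr _ _).
  have GE : G != E by apply: contraTneq ltXF => GE; rewrite -rG GE ltnn.
  move: sG; rewrite subUset => /andP[sXG sFG].
  rewrite (cyclic_flat_sub_eq cF cG F0 GE sFG).
  by rewrite (cyclic_flat_sub_eq (cs_l cs') cG (cs_neq0 cs') GE sXG).
have ltF : r F < r E.
  have [x xE xF] : exists2 x, x \in E & x \notin F.
    by apply/subsetPn; apply: contra FE => sEF; rewrite eqEsubset sFE.
  apply: leq_trans (flatF x xE xF) _; apply: rankS.
  by rewrite subUset sub1set xE.
have [|geX] := ltnP (r (X :|: F)) (r E); first by left; apply: (half X Y).
right; apply: (half Y X (contraction_splitC cs)); rewrite ltnNge.
apply/negP => geY.
have hX := rank_submod M X F; have hY := rank_submod M Y F.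
have hF : r F + r [set f] <= r (X :&: F) + r (Y :&: F).
  apply: rank_submod_le.
  - by rewrite -setIUl (cs_cover cs) subsetI sFE subxx.
  - by rewrite sub1set inE fF (cs_in cs).
  - by rewrite sub1set inE fF (cs_in (contraction_splitC cs)).
by move: (cs_rank cs) ltF geX geY hX hY hF; card_lia.
Qed.

(** If [e] and [e'] differ, label the parts so that [e'] lies in [A] and [e] in
    [A'].  Then [B'] avoids [e] and is not [A], so [B' = B] and [A - e'] is
    [A' - e].  As [e] is not a coloop of [A'], it is spanned by [A' - e], hence
    by the flat [A], which misses it. *)
Lemma deletion_split_unique e A B e' A' B' :
  deletion_split e A B -> deletion_split e' A' B' -> e = e'.
Proof.
move=> ds ds'; apply/eqP/idPn => nee'.
have eE := ds_ground ds; have e'E := ds_ground ds'.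
wlog e'A : A B ds / e' \in A => [IH|].
  have [|e'A] := boolP (e' \in A); first exact: (IH A B).
  by apply: (IH B A (deletion_splitC ds)); rewrite (ds_in ds) // eq_sym.
wlog eA' : A' B' ds' / e \in A' => [IH|].
  have [|eA'] := boolP (e \in A'); first exact: (IH A' B').
  by apply: (IH B' A' (deletion_splitC ds')); rewrite (ds_in ds').
have e'B' := ds_notin (deletion_splitC ds').
have eB' : e \notin B' by rewrite (ds_in ds') // eA'.
have eB : B' = B.
  have [BA|//] := cyclic_flat_avoiding ds (ds_r ds') (ds_r0 ds') eB'.
  by move: e'B'; rewrite BA e'A.
have eAA' : A :\ e' = A' :\ e.
  rewrite (ds_compl ds) (ds_compl ds') eB !setDDl; congr (_ :\: _).
  by rewrite [LHS]setUCA [RHS]setUC setUA.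
have [_ _ cycA'] := ds_l ds'.
have := flat_rank_lt (ds_l ds) (subsetDl A [set e']) eE (ds_notin ds).
by rewrite eAA' setD1K // (cycA' e eA') ltnn.
Qed.

(** If [f] and [f'] differ, label the parts so that [f'] lies in [X] and [f] in
    [X'].  Then [X'] contains [f] and is not [Y], so [X' = X] and [Y - f] is
    [Y' - f'].  As [f'] is not a coloop of [Y'], it is spanned by [Y' - f'],
    hence by the flat [Y], which misses it. *)
Lemma contraction_split_unique f X Y f' X' Y' :
  contraction_split f X Y -> contraction_split f' X' Y' -> f = f'.
Proof.
move=> cs cs'; apply/eqP/idPn => nff'.
have fE := cs_ground cs; have f'E := cs_ground cs'.
wlog f'X : X Y cs / f' \in X => [IH|].
  have [|f'X] := boolP (f' \in X); first exact: (IH X Y).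
  by apply: (IH Y X (contraction_splitC cs)); rewrite (cs_notin cs) // eq_sym.
wlog fX' : X' Y' cs' / f \in X' => [IH|].
  have [|fX'] := boolP (f \in X'); first exact: (IH X' Y').
  by apply: (IH Y' X' (contraction_splitC cs')); rewrite (cs_notin cs').
have f'Y : f' \notin Y by rewrite (cs_notin cs) ?f'X // eq_sym.
have eX : X' = X.
  have [//|XY] := cyclic_flat_containing cs (cs_l cs') (cs_lE cs') fX'.
  by move: f'Y; rewrite -XY (cs_in cs').
have f'Y' := cs_in (contraction_splitC cs').
have eYY' : Y :\ f = Y' :\ f' by rewrite (cs_compl cs) (cs_compl cs') eX.
have [_ _ cycY'] := cs_r cs'.
have := flat_rank_lt (cs_r cs) (subsetDl Y [set f]) f'E f'Y.
by rewrite eYY' setD1K // (cycY' f' f'Y') ltnn.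
Qed.

(** Label the parts so that [f] lies in [A] and [e] in [X].  Then [Y] avoids [e]
    and contains [f], so [Y = A]; hence [B], the complement of [Y] in [E - e],
    lies in [X].  Incomparability gives [B = X], but only [X] contains [f]. *)
Lemma not_both_split_neq e A B f X Y :
  e != f -> deletion_split e A B -> contraction_split f X Y -> False.
Proof.
move=> nef ds cs; have eE := ds_ground ds; have fE := cs_ground cs.
wlog fA : A B ds / f \in A => [IH|].
  have [|fA] := boolP (f \in A); first exact: (IH A B).
  by apply: (IH B A (deletion_splitC ds)); rewrite (ds_in ds) // eq_sym.
wlog eX : X Y cs / e \in X => [IH|].
  have [|eX] := boolP (e \in X); first exact: (IH X Y).
  by apply: (IH Y X (contraction_splitC cs)); rewrite (cs_notin cs).
have fB : f \notin B by rewrite (ds_in ds) ?fA // eq_sym.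
have eY : e \notin Y by rewrite (cs_notin cs) ?eX.
have csC := contraction_splitC cs.
have YA : Y = A.
  have [//|YB] := cyclic_flat_avoiding ds (cs_r cs) (cs_neq0 csC) eY.
  by move: fB; rewrite -YB (cs_in csC).
have BX : B = X.
  apply: cyclic_flat_sub_eq (ds_r ds) (cs_l cs) (ds_r0 ds) (cs_lE cs) _.
  apply/subsetP => x xB; have [sB _ _] := ds_r ds.
  have xE := subsetP sB x xB.
  have nxe : x != e.
    by apply: contraNneq (ds_notin (deletion_splitC ds)) => <-.
  have nxf : x != f by apply: contraNneq fB => <-.
  by rewrite (cs_notin csC) // YA -(ds_in ds).
by move: fB; rewrite BX (cs_in cs).
Qed.

(** The ranks of the traces of [X] and [Y] on [A] and [B] add up to at most
    [r A + r B + 1], one more than the least possible value.  So on one of [A]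
    and [B], say [A], the two traces form a direct sum; a nonempty trace is then
    a cyclic flat, hence all of [A], and [A] lies in [X] or in [Y]. *)
Lemma not_both_split_eq e A B X Y :
  deletion_split e A B -> contraction_split e X Y -> False.
Proof.
move=> ds cs; have eE := ds_ground ds.
have half A' B' : deletion_split e A' B' ->
    r (X :&: A') + r (Y :&: A') <= r A' -> False.
  move=> ds' le; have eA := ds_notin ds'; have [sA _ _] := ds_l ds'.
  have sub_false X' Y' : contraction_split e X' Y' -> A' \subset X' -> False.
    move=> cs' sAX; move: eA.
    have -> // : A' = X'; last by rewrite (cs_in cs').
    exact: cyclic_flat_sub_eq (ds_l ds') (cs_l cs') (ds_l0 ds') (cs_lE cs') sAX.
  have sAXY : A' \subset (X :&: A') :|: (Y :&: A').
    by rewrite -setIUl (cs_cover cs) subsetI sA subxx.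
  have [XA0|XA0] := eqVneq (X :&: A') set0.
    apply: (sub_false Y X (contraction_splitC cs)).
    by move: sAXY; rewrite XA0 set0U subsetI => /andP[].
  have cXA : rank_cyclic_flat (X :&: A').
    apply: cyclic_flat_cap (cs_l cs) (ds_l ds') (ds_l ds') _ sAXY le.
    exact: subsetIr.
  apply: (sub_false X Y cs); rewrite -{1}(cyclic_flat_sub_eq cXA (ds_l ds')) //.
  - exact: subsetIl.
  - exact: ds_neqE ds'.
  - exact: subsetIr.
have le : r A + r B <= r (A :|: B) by rewrite (ds_cover ds) (ds_rank ds).
have rankXY X' Y' : contraction_split e X' Y' ->
    r X' = r (X' :&: A) + r (X' :&: B).
  move=> cs'; have [sX _ cycX] := cs_l cs'; rewrite -(cycX e (cs_in cs')).
  rewrite (rank_separated le (ds_disj ds)); last by rewrite (ds_cover ds) setSD.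
  congr (r _ + r _); rewrite setIDAC; apply/setDidPl.
    by rewrite disjoint_sym disjoints1 inE negb_and (ds_notin ds) orbT.
  rewrite disjoint_sym disjoints1 inE negb_and.
  by rewrite (ds_notin (deletion_splitC ds)) orbT.
have hX := rankXY X Y cs; have hY := rankXY Y X (contraction_splitC cs).
have [leA|ltA] := leqP (r (X :&: A) + r (Y :&: A)) (r A).
  exact: half ds leA.
apply: (half B A (deletion_splitC ds)).
have leE : r (E :\ e) <= r A + r B by rewrite -(ds_cover ds) rankU.
have [sX _ cycX] := cs_l cs.
have := rank_noncoloop (cs_in cs) (cycX e (cs_in cs)) sX.
have := rank_le_card M [set e]; rewrite cards1.
by move: (cs_rank cs) leE ltA hX hY; card_lia.
Qed.

End CyclicFlats.

(** * Disconnected single-element deletions and contractions *)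

Lemma contraction_rank (T : finType) (M : matroid T) (f : T) (X : {set T}) :
  f \in ground M -> X \subset ground M :\ f ->
  rank (contraction M [set f]) X + rank M [set f] = rank M (f |: X).
Proof.
move=> fE sX; set E := ground M in fE sX *.
(* The contraction is the dual of a deletion of the dual: apply the dual rank
   formula to [X] outside, then to [E - f] and [E - f - X] inside. *)
have sfE : E :\ f \subset E := subsetDl _ _.
have sfX : f |: X \subset E by rewrite subUset sub1set fE (subset_trans sX).
have /= := @dual_rank T (deletion (dual M) [set f]) X sX.
rewrite !(@deletion_rank _ (dual M)) ?subsetDl //.
have := dual_rank sfE; rewrite setDDr setDv set0U (setIidPr _) ?sub1set //.
have := @dual_rank T M (E :\ f :\: X) (subset_trans (subsetDl _ _) sfE).
rewrite setDDl setDDr setDv set0U (setIidPr sfX).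
have := cardsID X (E :\ f); rewrite (setIidPr sX) setDDl.
by card_lia.
Qed.

Section DisconnectedMinors.

Variables (T : finType) (M : matroid T).
Implicit Types (A B P Q X Z : {set T}) (e f x : T).

Local Notation r := (rank M).
Local Notation E := (ground M).

Lemma simple_rank Z : simple M -> Z \subset E -> #|Z| <= 2 -> r Z = #|Z|.
Proof. by move=> sM sZ cZ; apply: rank_indep; apply: simple_indep. Qed.

Lemma simple_rank1 x : simple M -> x \in E -> r [set x] = 1.
Proof. by move=> sM xE; rewrite simple_rank ?sub1set ?cards1. Qed.

Lemma cosimple_rank Z : cosimple M -> Z \subset E -> #|Z| <= 2 ->
  r (E :\: Z) = r E.
Proof.
move=> cM sZ cZ; have iZ := simple_indep (M := dual M) cM sZ cZ.
by have := dual_rank sZ; rewrite (rank_indep iZ) => /addnI.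
Qed.

Hypotheses (M_simple : simple M) (M_cosimple : cosimple M).
Hypothesis M_connected : connected M.

Lemma ground_gt1 : 1 < #|E|.
Proof.
have /andP[/set0Pn[x xE] _] := M_connected.
rewrite ltnNge; apply/negP => cE.
have cE2 : #|E| <= 2 by apply: leq_trans cE _.
have := cosimple_rank M_cosimple (subxx E) cE2; rewrite setDv.
have := rank_le_card M set0; rewrite cards0 leqn0 => /eqP ->.
rewrite (simple_rank M_simple (subxx E) cE2) => /esym/eqP.
by rewrite cards_eq0 => /eqP E0; rewrite E0 inE in xE.
Qed.

Lemma groundD1_neq0 e : e \in E -> E :\ e != set0.
Proof.
move=> eE; rewrite -cards_eq0 -lt0n; have := ground_gt1.
by rewrite (cardsD1 e) eE.
Qed.

(** If [A] spanned [e], then [e |: A] and [B] would separate [M]; if it spanned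
    some [x] in [B], then [x] would be a loop.  A coloop [x] of [A] would be in
    series with [e]. *)
Lemma deletion_summand_cyclic_flat e A B :
  e \in E -> A :|: B = E :\ e -> A :&: B = set0 -> B != set0 ->
  r A + r B <= r (E :\ e) -> rank_cyclic_flat M A.
Proof.
move=> eE eAB dAB B0 le.
have eB : e \notin B by have := subsetUr A B; rewrite eAB subsetD1 => /andP[].
have sA : A \subset E.
  by apply: subset_trans (subsetDl E [set e]); rewrite -eAB subsetUl.
split=> // x.
  move=> xE xA; have [->|nxe] := eqVneq x e.
    rewrite ltnNge; apply/negP => leA.
    have leE : r (E :\ e) <= r E by rewrite rankS ?subsetDl.
    apply: (@connected_separation _ _ (e |: A) B M_connected); split=> //.
    - by apply/set0Pn; exists e; rewrite setU11.
    - by rewrite -setUA eAB setD1K.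
    - rewrite setIUl dAB setU0; apply/eqP; rewrite setI_eq0 disjoints1.
      exact: eB.
    - by move: leA le leE; card_lia.
  have xB : x \in B.
    by have /setP/(_ x) := eAB; rewrite !inE nxe xE (negbTE xA).
  have : r (E :\ e) + r [set x] <= r (x |: A) + r B.
    apply: rank_submod_le; rewrite ?sub1set ?setU11 // -setUA eAB.
    exact: subsetU1.
  by move: le; rewrite (simple_rank1 M_simple xE); card_lia.
move=> xA; apply/eqP; rewrite eqn_leq rankS ?subsetDl //=.
have sex : [set e; x] \subset E by rewrite subUset !sub1set eE (subsetP sA).
have cex : #|[set e; x]| <= 2 by rewrite cards2; case: (e != x).
have := cosimple_rank M_cosimple sex cex.
have : r (E :\: [set e; x]) <= r (A :\ x) + r B.
  apply: leq_trans (rankU _ _ _); apply: rankS; apply/subsetP => y.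
  rewrite !inE negb_or => /andP[/andP[nye nyx] yE]; rewrite nyx /=.
  by have /setP/(_ y) := eAB; rewrite !inE nye yE.
have : r (E :\ e) <= r E by rewrite rankS ?subsetDl.
by move: le; card_lia.
Qed.

Lemma deletion_split_exists e : e \in E ->
  disconnected (deletion M [set e]) -> exists A B, deletion_split M e A B.
Proof.
move=> eE dis; have [|A [B]] :=
  @disconnected_separation _ (deletion M [set e]) _ dis.
  exact: groundD1_neq0.
case=> A0 B0 /= eAB dAB.
rewrite !deletion_rank -?eAB ?subsetUl ?subsetUr // eAB => le.
exists A, B; split=> //.
  exact: (deletion_summand_cyclic_flat eE eAB dAB B0 le).
apply: (deletion_summand_cyclic_flat eE _ _ A0); rewrite 1?setUC 1?setIC //.
by rewrite addnC.
Qed.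

(** An element of [Q] spanned by [f |: P] would be a loop of [M / f], hence
    parallel to [f].  If [f] were a coloop of [f |: P], then [P] and [f |: Q]
    would separate [M]; any other coloop of [f |: P] would be a coloop of
    [M]. *)
Lemma contraction_summand_cyclic_flat f P Q :
  f \in E -> P :|: Q = E :\ f -> P :&: Q = set0 -> P != set0 ->
  r (f |: P) + r (f |: Q) <= r E + r [set f] -> rank_cyclic_flat M (f |: P).
Proof.
move=> fE ePQ dPQ P0; rewrite (simple_rank1 M_simple fE) => le.
have fP : f \notin P by have := subsetUl P Q; rewrite ePQ subsetD1 => /andP[].
have sP : f |: P \subset E.
  rewrite subUset sub1set fE; apply: subset_trans (subsetDl E [set f]).
  by rewrite -ePQ subsetUl.
have eE : (f |: P) :|: (f |: Q) = E by rewrite -setUUr ePQ setD1K.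
split=> // x.
  rewrite !inE negb_or => xE /andP[nxf xP].
  have xQ : x \in Q.
    by have /setP/(_ x) := ePQ; rewrite !inE nxf xE (negbTE xP).
  have sfx : [set f; x] \subset E by rewrite subUset !sub1set fE.
  have : r E + r [set f; x] <= r (x |: (f |: P)) + r (f |: Q).
    apply: rank_submod_le.
    - by rewrite -setUA eE subsetU1.
    - by rewrite subUset !sub1set !inE !eqxx orbT.
    - by rewrite subUset !sub1set !inE eqxx xQ orbT.
  rewrite (simple_rank M_simple sfx) cards2 eq_sym nxf //.
  by move: le; card_lia.
move=> xfP; apply/eqP; rewrite eqn_leq rankS ?subsetDl //=.
have [->|nxf] := eqVneq x f.
  rewrite setU1K // leqNgt; apply/negP => ltP.
  apply: (@connected_separation _ _ P (f |: Q) M_connected); split=> //.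
  - by apply/set0Pn; exists f; rewrite setU11.
  - by rewrite setUCA ePQ setD1K.
  - by rewrite setIUr dPQ setU0; apply/eqP; rewrite setIC setI_eq0 disjoints1.
  - by move: le ltP; card_lia.
have xE : x \in E := subsetP sP x xfP.
have : r (E :\ x) + r [set f] <= r ((f |: P) :\ x) + r (f |: Q).
  apply: rank_submod_le.
  - by rewrite subDset setUA setD1K // eE.
  - by rewrite sub1set !inE eqxx eq_sym nxf.
  - by rewrite sub1set setU11.
have sx : [set x] \subset E by rewrite sub1set.
rewrite (cosimple_rank M_cosimple sx) ?cards1 // (simple_rank1 M_simple fE).
by move: le; card_lia.
Qed.

Lemma contraction_split_exists f : f \in E ->
  disconnected (contraction M [set f]) -> exists X Y, contraction_split M f X Y.
Proof.
move=> fE dis; have [|P [Q]] :=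
  @disconnected_separation _ (contraction M [set f]) _ dis.
  exact: groundD1_neq0.
case=> P0 Q0 /= ePQ dPQ.
have sP : P \subset E :\ f by rewrite -ePQ subsetUl.
have sQ : Q \subset E :\ f by rewrite -ePQ subsetUr.
have := contraction_rank fE sP; have := contraction_rank fE sQ.
have := contraction_rank fE (subxx (E :\ f)); rewrite setD1K //.
move=> hE hQ hP hle.
have le : r (f |: P) + r (f |: Q) <= r E + r [set f].
  by move: hE hQ hP hle; rewrite -/E; card_lia.
have neE P' Q' : P' :|: Q' = E :\ f -> P' :&: Q' = set0 -> Q' != set0 ->
    f |: P' != E.
  move=> eU dI /set0Pn[x xQ]; apply: contraTneq xQ => fPE.
  apply/negP => xQ; have xEf : x \in E :\ f by rewrite -eU inE xQ orbT.
  have [nxf xE] := setD1P xEf; move: (xE).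
  rewrite -fPE in_setU1 (negbTE nxf) /= => xP.
  by have := in_set0 x; rewrite -dI inE xP xQ.
exists (f |: P), (f |: Q); split=> //.
- exact: (contraction_summand_cyclic_flat fE ePQ dPQ P0 le).
- apply: (@contraction_summand_cyclic_flat f Q P fE _ _ Q0).
  + by rewrite setUC.
  + by rewrite setIC.
  + by rewrite [leqLHS]addnC.
- exact: neE ePQ dPQ Q0.
- by apply: (neE Q P); rewrite 1?setUC 1?setIC.
- by rewrite -setUUr ePQ setD1K.
- by rewrite -setUIr dPQ setU0.
Qed.

End DisconnectedMinors.

(** * The bound *)

Theorem proposition4p2 (T : finType) (M : matroid T)
    (M_simple : simple M) (M_cosimple : cosimple M)
    (M_connected : connected M) (M_split : elementary_split M) :
  #|[set e in ground M | disconnected (deletion M [set e])]|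
    + #|[set e in ground M | disconnected (contraction M [set e])]| <= 1
  /\ exists2 e, e \in ground M &
       connected (deletion M [set e]) /\ connected (contraction M [set e]).
Proof.
set D := [set e in _ | disconnected (deletion _ _)].
set K := [set e in _ | disconnected (contraction _ _)].
have splitD e : e \in D -> exists A B, deletion_split M e A B.
  by rewrite inE => /andP[eE]; apply: deletion_split_exists.
have splitK f : f \in K -> exists X Y, contraction_split M f X Y.
  by rewrite inE => /andP[fE]; apply: contraction_split_exists.
have D1 : #|D| <= 1.
  apply/card_le1_eqP => e e' /splitD[A [B ds]] /splitD[A' [B' ds']].
  exact: (deletion_split_unique M_split ds' ds).
have K1 : #|K| <= 1.
  apply/card_le1_eqP => f f' /splitK[X [Y cs]] /splitK[X' [Y' cs']].
  exact: (contraction_split_unique M_split cs' cs).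
have DK : #|D| + #|K| <= 1.
  have [->|[e eD]] := set_0Vmem D; first by rewrite cards0.
  have [->|[f fK]] := set_0Vmem K; first by rewrite cards0 addn0.
  have [[A [B ds]] [X [Y cs]]] := (splitD e eD, splitK f fK).
  have [ef|nef] := eqVneq e f.
    rewrite -ef in cs.
    by case: (not_both_split_eq M_split ds cs).
  by case: (not_both_split_neq M_split nef ds cs).
split=> //.
have [e eE eDK] : exists2 e, e \in ground M & e \notin D :|: K.
  apply/subsetPn; apply: contraL (ground_gt1 M_simple M_cosimple M_connected).
  move=> /subset_leq_card leE; rewrite -leqNgt.
  by apply: leq_trans (leq_trans leE _) DK; rewrite cardsU leq_subr.
exists e => //; move: eDK; rewrite in_setU negb_or !in_set eE /=.
by rewrite /disconnected !negbK => /andP.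
Qed.
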